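(* Let $p\ge 5$ be a prime. Then the following three congruences hold: \begin{align*} &\sum_{k=0}^{p-1}M_k^2\equiv \left(\frac{p}{3}\right)\left(2-6p\right)\pmod{p^2},\\ &\sum_{k=0}^{p-1}kM_k^2\equiv \left(\frac{p}{3}\right)\left(9p-1\right)\pmod{p^2},\\ &\sum_{k=0}^{p-1}T_kM_k\equiv \frac{4}{3}\left(\frac{p}{3}\right)+\frac{p}{6}\left(1-9\left(\frac{p}{3}\right)\right)\pmod{p^2}. \end{align*}
   Context: For an integer $n\ge 0$, $C_n=\binom{2n}{n}/(n+1)$ is the $n$th Catalan number; $M_n=\sum_{k=0}^{\lfloor n/2\rfloor}\binom{n}{2k}C_k$ is the $n$th Motzkin number; and $T_n=\sum_{k=0}^{\lfloor n/2\rfloor}\binom{n}{2k}\binom{2k}{k}$ is the $n$th central trinomial coefficient (the constant term of $(1+x+x^{-1})^n$). $\left(\frac{\cdot}{3}\right)$ is the Legendre symbol modulo $3$: $\left(\frac{a}{3}\right)=0,1,-1$ according as $a\equiv 0,1,2\pmod 3$. Congruences modulo $p^2$ between rational numbers whose denominators are prime to $p$ are taken in the ring of $p$-integral rationals: $a\equiv b\pmod{p^2}$ means that $(a-b)/p^2$ is a rational number with denominator prime to $p$. *)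

(* Defs.v *)
From mathcomp Require Import all_boot all_order all_algebra.

Set Implicit Arguments.
Unset Strict Implicit.
Unset Printing Implicit Defensive.

Import Order.TTheory GRing.Theory Num.Theory.

Local Open Scope ring_scope.

Definition catalan (n : nat) : rat := 'C(2 * n, n)%:R / n.+1%:R.

Definition motzkin (n : nat) : rat :=
  \sum_(k < n./2.+1) 'C(n, 2 * k)%:R * catalan k.

Definition central_trinomial (n : nat) : rat :=
  \sum_(k < n./2.+1) 'C(n, 2 * k)%:R * 'C(2 * k, k)%:R.

Definition legendre3 (a : int) : int :=
  if (a == 0 %[mod 3])%Z then 0
  else if (a == 1 %[mod 3])%Z then 1 else -1.

Definition p_integral (p : nat) (x : rat) : bool := coprime `|denq x|%N p.

Definition eqmod_p2 (p : nat) (a b : rat) : bool :=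
  p_integral p ((a - b) / p%:R ^+ 2).

(* Main.v *)
Require Import Defs.
From mathcomp Require Import all_boot all_order all_algebra.
From mathcomp Require Import ring zify.

Set Implicit Arguments.
Unset Strict Implicit.
Unset Printing Implicit Defensive.

Import Order.TTheory GRing.Theory Num.Theory.

Local Open Scope ring_scope.

(** Write [T] and [M] for the central trinomial and Motzkin numbers. From
    [T (n+2) = T (n+1) + 2(n+1) M n] and [2(n+2) M n = T (n+1) + 3 T n] one
    finds that each of the three sums is, up to an explicit quadratic form in
    [T p] and [T (p+1)], a multiple of
    [g = \sum_(n < p) T n * (T n + T (n+1))]. Working in a ring where
    [p^2 = 0], with [e = (p/3)], it remains to show [T p = 1],
    [T (p-1) = e 3^(p-1)] and [g = 2e].

    The values [T (p-1)] and [T p] come from the coefficients of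
    [(1 + x + x^2)^p] summed over residue classes mod 3, using the symmetries
    [i |-> 2p - i] and [i |-> p - i].

    For [g], expand [G(z) = \sum_(n < p) T n * z^n] in powers of [w = 1 + z].
    As [z = -1] is a singular point of the differential equation of [G], the
    coefficients obey a first-order recurrence; and since [z = x + 1 + 1/x]
    gives [w = (1+x)^2/x], [g] is the combination of these coefficients with
    weights [2 'C(2k+1, k)]. The coefficients of [V], the rational part of
    [(1 + sqrt (12x - 3))^p], solve the same recurrence up to geometric terms,
    so that [g] reduces to [V(1) - V(0) = 2^p - 2] and to binomial sums. *)

(** * Integrality and recurrences *)

(** A difference of binomials avoids division; [catalan_natM] recovers the quotient. *)
Definition catalan_nat (n : nat) : nat := 'C(2 * n, n) - 'C(2 * n, n.+1).

Definition motzkin_nat (n : nat) : nat :=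
  \sum_(k < n./2.+1) 'C(n, 2 * k) * catalan_nat k.

Definition trinomial_nat (n : nat) : nat :=
  \sum_(k < n./2.+1) 'C(n, 2 * k) * 'C(2 * k, k).

Lemma catalan_natM n : (n.+1 * catalan_nat n = 'C(2 * n, n))%N.
Proof.
have /= := mul_bin_left (2 * n) n; rewrite (_ : 2 * n - n = n)%N; last by lia.
by rewrite /catalan_nat => h; rewrite mulnBr h; nia.
Qed.

Lemma catalanE n : catalan n = (catalan_nat n)%:R.
Proof. by rewrite /catalan -catalan_natM natrM mulrAC divff ?mul1r ?pnatr_eq0.
  Qed.

Lemma motzkinE n : motzkin n = (motzkin_nat n)%:R.
Proof. by rewrite natr_sum; apply: eq_bigr => k _; rewrite natrM catalanE. Qed.

Lemma central_trinomialE n : central_trinomial n = (trinomial_nat n)%:R.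
Proof. by rewrite natr_sum; apply: eq_bigr => k _; rewrite natrM. Qed.

Lemma big_ord_even (V : nmodType) (F : nat -> V) n :
  \sum_(k < n.+1) (if odd k then 0 else F k./2) = \sum_(j < n./2.+1) F j.
Proof.
elim: n => [|n IHn]; first by rewrite !big_ord1.
rewrite big_ord_recr IHn /= uphalf_half.
by case: (odd n) => /=; rewrite ?addr0 // add1n [RHS]big_ord_recr.
Qed.

(** * Coefficients of the powers of [1 + x + x^2] *)

Section TrinomialPoly.

Variable R : comNzRingType.

(** Grouped so that [exprDn] separates powers of ['X] from powers of [1 + 'X^2]. *)
Definition trin : {poly R} := 'X + (1 + 'X^2).

Lemma coef_trinM (q : {poly R}) i :
  (trin * q)`_i.+2 = q`_i.+2 + q`_i.+1 + q`_i.
Proof. by rewrite !mulrDl mul1r !coefD coefXM coefXnM subn2 /=; ring. Qed.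

Lemma coef0_trinM (q : {poly R}) : (trin * q)`_0 = q`_0.
Proof. by rewrite !mulrDl mul1r !coefD coefXM coefXnM /=; ring. Qed.

Lemma coef1_trinM (q : {poly R}) : (trin * q)`_1 = q`_1 + q`_0.
Proof. by rewrite !mulrDl mul1r !coefD coefXM coefXnM /=; ring. Qed.

Lemma coef_1DX2_exp k i :
  ((1 + 'X^2 : {poly R}) ^+ k)`_i = if odd i then 0 else ('C(k, i./2))%:R.
Proof.
rewrite exprDn coef_sum.
under eq_bigr => j _ do
  rewrite expr1n mul1r -exprM coefMn coefXn -mulrnA.
case: ifP => oi.
  apply: big1 => j _; case: eqP => [ij|]; last by rewrite mul0n.
  by move: oi; rewrite ij oddM.
have [lt|ge] := ltnP i./2 k.+1; last first.
  rewrite bin_small ?ltnS //; apply: big1 => j _.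
  case: eqP => [ij|]; last by rewrite mul0n.
  by have := ltn_ord j; lia.
rewrite (bigD1 (Ordinal lt)) //= big1 ?addr0 => [|j /eqP nj].
  by rewrite (_ : i == _) ?mul1n //; lia.
case: eqP => [ij|]; last by rewrite mul0n.
by case: nj; apply: val_inj => /=; lia.
Qed.

Lemma coef_trin_exp n i :
  (trin ^+ n)`_i = \sum_(k < n.+1) ('C(n, k))%:R *
    (if (i < n - k)%N then 0 else ((1 + 'X^2 : {poly R}) ^+ k)`_(i - (n - k))).
Proof.
rewrite /trin exprDn coef_sum; apply: eq_bigr => k _.
by rewrite coefMn coefXnM mulr_natl.
Qed.

Lemma coef_trin_trinomial n : (trin ^+ n)`_n = (trinomial_nat n)%:R.
Proof.
rewrite coef_trin_exp natr_sum.
rewrite -(big_ord_even (fun j => ('C(n, 2 * j) * 'C(2 * j, j))%:R)).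
apply: eq_bigr => k _; have := ltn_ord k => ltk.
rewrite (_ : (n < n - k)%N = false); last by lia.
rewrite (_ : (n - (n - k) = k)%N); last by lia.
rewrite coef_1DX2_exp; case: ifP => ok; first by rewrite mulr0.
by rewrite natrM (_ : (2 * k./2 = k)%N) //; lia.
Qed.

(** ['C(2j+1, j)] is [2j+1] times the [j]th Catalan number, and
    [(2j+1) 'C(n+1, 2j+1) = (n+1) 'C(n, 2j)]. *)
Lemma coef_trin_motzkin n : (trin ^+ n.+1)`_n = (n.+1 * motzkin_nat n)%:R.
Proof.
rewrite coef_trin_exp big_ord_recl /= subn0 ltnSn mulr0 add0r.
rewrite /motzkin_nat big_distrr natr_sum /=.
rewrite -(big_ord_even (fun j => (n.+1 * ('C(n, 2 * j) * catalan_nat j))%:R)).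
apply: eq_bigr => k _; have := ltn_ord k => ltk.
rewrite /bump /= add1n.
rewrite (_ : (n < n.+1 - k.+1)%N = false); last by lia.
rewrite (_ : (n - (n.+1 - k.+1) = k)%N); last by lia.
rewrite coef_1DX2_exp; case: ifP => ok; first by rewrite mulr0.
rewrite (_ : (2 * k./2 = k)%N); last by lia.
rewrite -natrM; congr (_%:R); rewrite mulnA mul_bin_diag.
rewrite mulnC mulnAC; congr (_ * _)%N.
rewrite -[in k.+1](odd_double_half k) ok add0n -mul2n.
have := catalan_natM k./2; have /= := mul_bin_down (2 * k./2).+1 k./2.
rewrite (_ : (2 * k./2).+1 - k./2 = k./2.+1)%N; last by lia.
nia.
Qed.

Lemma coef_trin_exp_deriv n i :
  (trin ^+ n.+1)`_i.+2 *+ i.+2 =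
  ((trin ^+ n)`_i.+1 + (trin ^+ n)`_i *+ 2) *+ n.+1.
Proof.
rewrite -coef_deriv deriv_exp /= !derivD derivX derivXn derivC add0r coefMn.
by congr (_ *+ _); rewrite mulrDl mul1r coefD mulrnAl coefMn coefXM.
Qed.

Lemma coef0_trin_exp n : (trin ^+ n)`_0 = 1.
Proof. by elim: n => [|n IHn]; rewrite ?expr0 ?coefC // exprS coef0_trinM. Qed.

Lemma coef1_trin_exp n : (trin ^+ n)`_1 = n%:R.
Proof.
elim: n => [|n IHn]; first by rewrite expr0 coefC.
by rewrite exprS coef1_trinM IHn coef0_trin_exp natr1.
Qed.

Lemma coef_trin_exp_gt n i : (2 * n < i)%N -> (trin ^+ n)`_i = 0.
Proof.
elim: n i => [|n IHn] [|[|i]] //; first by rewrite expr0 coefC.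
  by rewrite expr0 coefC.
by move=> lti; rewrite exprS coef_trinM !IHn ?addr0 //; lia.
Qed.

(** [trin] is palindromic. Indices 0 and 1 at either end are treated apart because [coef_trinM]
    starts at index 2. *)
Lemma coef_trin_exp_sym n i j :
  (i + j = 2 * n)%N -> (trin ^+ n)`_i = (trin ^+ n)`_j.
Proof.
elim: n i j => [|n IHn]; first by case=> [|?] [|?].
have aux0 j : j = (2 * n.+1)%N -> (trin ^+ n.+1)`_0 = (trin ^+ n.+1)`_j.
  move=> ->; rewrite (_ : 2 * n.+1 = (2 * n).+2)%N; last by lia.
  rewrite exprS coef_trinM coef0_trinM (IHn 0 (2 * n)%N) //.
  rewrite (coef_trin_exp_gt (i := (2 * n).+2)); last by lia.
  by rewrite (coef_trin_exp_gt (i := (2 * n).+1)) // !add0r.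
have aux1 j : j.+1 = (2 * n.+1)%N -> (trin ^+ n.+1)`_1 = (trin ^+ n.+1)`_j.
  case: n IHn {aux0} => [|n] IHn; first by case=> ->.
  move=> ej; have {ej} -> : j = (2 * n).+3 by lia.
  rewrite exprS coef_trinM coef1_trinM (IHn 1 (2 * n).+1)%N; last by lia.
  rewrite (IHn 0 (2 * n).+2)%N; last by lia.
  rewrite (coef_trin_exp_gt (i := (2 * n).+3)); last by lia.
  by rewrite add0r addrC.
case=> [|[|i]] [|[|j]] eij //.
- by apply: aux0; lia.
- by apply: aux0; lia.
- by lia.
- by apply: aux1; lia.
- by rewrite -aux0 //; lia.
- by rewrite -aux1 //; lia.
- rewrite exprS !coef_trinM (IHn i.+2 j) 1?(IHn i.+1 j.+1) 1?(IHn i j.+2);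
  [|lia..].
  by ring.
Qed.

End TrinomialPoly.

Lemma trinomialSS n :
  trinomial_nat n.+2 = (trinomial_nat n.+1 + 2 * n.+1 * motzkin_nat n)%N.
Proof.
have := coef_trin_trinomial int n.+2.
rewrite exprS coef_trinM (coef_trin_exp_sym int (j := n)); last by lia.
rewrite coef_trin_trinomial coef_trin_motzkin !natz; lia.
Qed.

Lemma motzkin_trinomial n :
  (2 * n.+2 * motzkin_nat n = trinomial_nat n.+1 + 3 * trinomial_nat n)%N.
Proof.
case: n => [|n]; first by rewrite /motzkin_nat /trinomial_nat !big_ord1.
set a := trinomial_nat n.+1.
(* [c] is the coefficient of [x^(n-1)] in [trin ^+ n.+1], or 0 if [n = 0]. The first relation comes
   from multiplying by [trin], the second from differentiating; [c] is then eliminated. *)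
have [c h1 h2] : exists2 c : int,
    (n.+1 * motzkin_nat n)%:Z * 1 + a%:Z + c = (n.+2 * motzkin_nat n.+1)%:Z
  & (n.+2 * motzkin_nat n.+1 * n.+1)%:Z =
    ((n.+1 * motzkin_nat n)%:Z + c * 2) * n.+2%:Z.
  have := coef_trin_motzkin int n.+1.
  case: n @a => [|n] a; rewrite exprS.
    rewrite coef1_trinM coef_trin_trinomial coef_trin_motzkin !natz => h.
    by exists 0; rewrite /a /motzkin_nat /trinomial_nat !big_ord1.
  rewrite coef_trinM coef_trin_trinomial (coef_trin_motzkin _ n.+1) !natz => h.
  exists ((trin int ^+ n.+2)`_n); first by lia.
  have := coef_trin_exp_deriv int n.+2 n.
  rewrite !coef_trin_motzkin -[_ *+ n.+2]mulr_natr -[_ *+ n.+3]mulr_natr !natz.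
  rewrite -[_ *+ 2]mulr_natr natz => {}h; rewrite -h; lia.
rewrite trinomialSS -/a.
move: (motzkin_nat n.+1) (motzkin_nat n) h1 h2 => x y h1.
have {h1}-> : c = n.+2%:Z * x%:Z - a%:Z - n.+1%:Z * y%:Z by rewrite -!PoszM;
  lia.
rewrite !PoszM => h2; apply/eqP; rewrite -eqz_nat; apply/eqP.
apply: (mulfI (_ : n.+2%:Z != 0)); first by [].
move: h2; rewrite !(PoszM, PoszD, intS); lia.
Qed.

Lemma trinomial0 : trinomial_nat 0 = 1%N.
Proof. by rewrite /trinomial_nat big_ord1. Qed.

Lemma trinomial1 : trinomial_nat 1 = 1%N.
Proof. by rewrite /trinomial_nat big_ord1. Qed.

(** * Reduction of the three sums *)

Section Telescoping.

Variable R : comNzRingType.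

Local Notation T n := ((trinomial_nat n)%:R : R).
Local Notation M n := ((motzkin_nat n)%:R : R).

Lemma trinomial_next n : T n.+1 = 2 * (n%:R + 2) * M n - 3 * T n.
Proof.
have /(congr1 (fun k => k%:R : R)) := motzkin_trinomial n.
have n2 : n.+2%:R = n%:R + 2 :> R by rewrite -addn2 natrD.
by rewrite [RHS]natrD !natrM n2 => ->; ring.
Qed.

Lemma trinomial_next2 n : T n.+2 = T n.+1 + 2 * (n%:R + 1) * M n.
Proof. by rewrite trinomialSS natrD !natrM -[n.+1%:R]natr1. Qed.

Lemma trinomial_rec n :
  (n%:R + 2) * T n.+2 = (2 * n%:R + 3) * T n.+1 + 3 * (n%:R + 1) * T n.
Proof. by rewrite trinomial_next2 trinomial_next; ring. Qed.

(** With [T n.+1] and [T n.+2] expressed through [T n] and [M n], the induction step is a polynomial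
    identity, free of division by [n + 2]. *)
Lemma sum_trinomial_motzkin n :
  6 * \sum_(k < n) T k * M k =
  4 * (\sum_(k < n) T k * (T k + T k.+1)) + 4 * T n ^+ 2 - 5 * T n * T n.+1
  + T n.+1 ^+ 2 + n%:R * (3 * T n - T n.+1) ^+ 2.
Proof.
elim: n => [|n IHn].
  by rewrite !big_ord0 trinomial0 trinomial1; ring.
rewrite !big_ord_recr /= mulrDr IHn (trinomial_next2 n) (trinomial_next n).
ring.
Qed.

Lemma sum_motzkin_sqr n :
  4 * \sum_(k < n) M k ^+ 2 =
  4 * (\sum_(k < n) T k * (T k + T k.+1)) + 13 * T n ^+ 2 - 14 * T n * T n.+1
  + 3 * T n.+1 ^+ 2 - 2 + 2 * n%:R * (3 * T n - T n.+1) ^+ 2.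
Proof.
elim: n => [|n IHn].
  by rewrite !big_ord0 trinomial0 trinomial1; ring.
rewrite !big_ord_recr /= mulrDr IHn (trinomial_next2 n) (trinomial_next n).
ring.
Qed.

Lemma sum_mul_motzkin_sqr n :
  4 * \sum_(k < n) k%:R * M k ^+ 2 =
  - 2 * (\sum_(k < n) T k * (T k + T k.+1)) - 20 * T n ^+ 2
  + 22 * T n * T n.+1 - 5 * T n.+1 ^+ 2 + 3
  - 3 * n%:R * (3 * T n - T n.+1) ^+ 2.
Proof.
elim: n => [|n IHn].
  by rewrite !big_ord0 trinomial0 trinomial1; ring.
rewrite !big_ord_recr /= mulrDr IHn (trinomial_next2 n) (trinomial_next n).
ring.
Qed.

End Telescoping.

(** * The generating polynomial expanded at its singular point *)

Lemma bin_centralS (R : comNzRingType) k :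
  k.+1%:R * ('C(2 * k.+1, k.+1))%:R =
  2 * (2 * k).+1%:R * ('C(2 * k, k))%:R :> R.
Proof.
rewrite -!natrM; congr (_%:R).
have /= h1 := mul_bin_diag (2 * k).+2 k.
have /= h2 := mul_bin_down (2 * k).+1 k.
rewrite (_ : (2 * k).+1 - k = k.+1)%N in h2; last by lia.
rewrite (_ : 2 * k.+1 = (2 * k).+2)%N; last by lia.
nia.
Qed.

Section TrinomialGF.

Variable R : comNzRingType.

Local Notation T n := (trinomial_nat n).
Local Notation Y := ('X - 1 : {poly R}).

Lemma derivXB1_exp n : (Y ^+ n)^`() = n%:R * Y ^+ n.-1.
Proof. by rewrite deriv_exp derivB derivX derivC subr0 mul1r mulr_natl. Qed.

(* The variable ['X] stands for [w = 1 + z]. *)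
Definition trinomial_gf n : {poly R} := \sum_(k < n) (T k)%:R * Y ^+ k.

(** The full series is [(1 - 2z - 3z^2)^(-1/2)], whence [(1 + z)(1 - 3z) G' = (1 + 3z) G]; the last
    term is the effect of truncation. *)
Lemma trinomial_gf_ode n :
  'X * (4 - 3 * 'X) * (trinomial_gf n.+1)^`() =
  (3 * 'X - 2) * trinomial_gf n.+1
  - n.+1%:R * Y ^+ n * ((T n.+1)%:R + 3 * (T n)%:R * Y).
Proof.
elim: n => [|n IHn].
  by rewrite /trinomial_gf big_ord1 trinomial0 trinomial1 mulr1 derivC; ring.
rewrite /trinomial_gf big_ord_recr derivD mulrDr {}IHn /=.
rewrite derivM -[(T n.+1)%:R]polyC_natr derivC mul0r add0r derivXB1_exp /=
  polyC_natr.
have rec := trinomial_rec {poly R} n.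
have -> : 'X * (4 - 3 * 'X) = (1 + Y) * (1 - 3 * Y) :> {poly R} by ring.
have -> : 3 * 'X - 2 = 1 + 3 * Y :> {poly R} by ring.
have n2 : n.+2%:R = n%:R + 2 :> {poly R} by rewrite -addn2 natrD.
rewrite !exprS n2.
have -> : (n%:R + 2) * (Y * Y ^+ n) * ((T n.+2)%:R + 3 * (T n.+1)%:R * Y) =
  Y * Y ^+ n * ((2 * n%:R + 3) * (T n.+1)%:R + 3 * (n%:R + 1) * (T n)%:R
     + 3 * (n%:R + 2) * (T n.+1)%:R * Y) by rewrite -rec; ring.
by rewrite -/(trinomial_gf n.+1); ring.
Qed.

Lemma coef_1DcX_exp (c : R) n k :
  ((1 + c%:P * 'X : {poly R}) ^+ n)`_k = c ^+ k * ('C(n, k))%:R.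
Proof.
rewrite exprDn coef_sum.
under eq_bigr => i _ do
  rewrite expr1n mul1r exprMn -rmorphXn coefMn coefCM coefXn.
have [kn|nk] := ltnP k n.+1; last first.
  rewrite bin_small ?mulr0 // big1 // => i _.
  by rewrite (_ : k == i = false) ?mulr0 ?mul0rn //; have := ltn_ord i; lia.
rewrite (bigD1 (Ordinal kn)) //= eqxx mulr1 big1 ?addr0 ?mulr_natr
  // => i /eqP ik.
rewrite (_ : k == i = false) ?mulr0 ?mul0rn //.
by apply/eqP => ki; apply: ik; apply: val_inj.
Qed.

Lemma coef_1DX_exp n k : ((1 + 'X : {poly R}) ^+ n)`_k = ('C(n, k))%:R.
Proof. by have := coef_1DcX_exp 1 n k; rewrite mul1r expr1n mul1r. Qed.

Lemma coef_XB1_exp n k : (Y ^+ n)`_k = (-1) ^+ (n - k) * ('C(n, k))%:R.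
Proof.
have [kn|nk] := leqP k n; last first.
  by rewrite bin_small // mulr0 nth_default // -[1]polyC1 size_exp_XsubC.
have -> : Y = (-1)%:P * (1 + (-1)%:P * 'X) by rewrite rmorphN1; ring.
rewrite exprMn -rmorphXn coefCM coef_1DcX_exp mulrA -exprD; congr (_ * _).
by rewrite -[LHS]signr_odd -[RHS]signr_odd oddD oddB.
Qed.

(* [(1 + x + x^2) / x = (1 + x)^2 / x - 1] *)
Lemma coef_1DX_trin_exp j n :
  ((1 + 'X) ^+ j * trin R ^+ n)`_n =
  \sum_(k < n.+1) (Y ^+ n)`_k * ('C(2 * k + j, k))%:R.
Proof.
have -> : trin R = - 'X + (1 + 'X) ^+ 2 by rewrite /trin; ring.
rewrite [(- _ + _) ^+ _]exprDn mulr_sumr coef_sum; apply: eq_bigr => k _.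
have kn := ltn_ord k.
have -> : (1 + 'X) ^+ j * ((- 'X) ^+ (n - k) * ((1
  + 'X) ^+ 2) ^+ k *+ 'C(n, k)) =
    ((Y ^+ n)`_k)%:P * ((1 + 'X) ^+ (2 * k + j) * 'X ^+ (n - k)).
  rewrite coef_XB1_exp rmorphM rmorphXn rmorphN1 rmorph_nat exprNn exprD exprM.
  by rewrite -mulr_natr; ring.
rewrite coefCM coefMXn ifF ?subKn ?coef_1DX_exp //; last by lia.
Qed.

Lemma sum_XB1_binom n :
  \sum_(k < n.+1) (Y ^+ n)`_k * ('C(2 * k, k))%:R = (T n)%:R.
Proof.
rewrite -coef_trin_trinomial -[trin R ^+ n]mul1r -(expr0 (1 + 'X)).
by rewrite coef_1DX_trin_exp; apply: eq_bigr => k _; rewrite addn0.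
Qed.

(** The extra factor [1 + x] makes the weight ['C(2k+1, k)] and adds to [T n] the neighbouring
    coefficient, half of [T n.+1 - T n]. *)
Lemma sum_XB1_binomS n :
  2 * \sum_(k < n.+1) (Y ^+ n)`_k * ('C((2 * k).+1, k))%:R
  = (T n)%:R + (T n.+1)%:R.
Proof.
under eq_bigr => k _ do rewrite -[(2 * k).+1]addn1.
rewrite -coef_1DX_trin_exp expr1 [(1 + 'X) * _]mulrDl mul1r coefD coefXM
  coef_trin_trinomial.
case: n => [|n]; first by rewrite trinomial0 trinomial1 /=; ring.
rewrite /= coef_trin_motzkin trinomial_next2 natrM -[n.+1%:R]natr1; ring.
Qed.

Lemma size_XB1_exp n : size (Y ^+ n) = n.+1.
Proof. by rewrite -[1]polyC1 size_exp_XsubC. Qed.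

(** The linear map [w^k |-> 2 'C(2k+1, k)] sends [z^i] to [T i + T i.+1]. *)
Lemma sum_trinomial_gf n :
  2 * \sum_(k < n) (trinomial_gf n)`_k * ('C((2 * k).+1, k))%:R =
  \sum_(k < n) (T k)%:R * ((T k)%:R + (T k.+1)%:R).
Proof.
rewrite /trinomial_gf; under eq_bigr => k _ do rewrite coef_sum mulr_suml.
rewrite exchange_big mulr_sumr; apply: eq_bigr => i _ /=.
rewrite -sum_XB1_binomS mulrCA; congr (2 * _).
rewrite (big_ord_widen n (fun k => (Y ^+ i)`_k * ('C((2 * k).+1, k))%:R)) //.
rewrite [X in _ = _ * X]big_mkcond mulr_sumr.
apply: eq_bigr => k _; rewrite -[(T i)%:R]polyC_natr coefCM -mulrA.
case: ifP => // ki; rewrite [_`_k]nth_default ?mul0r ?mulr0 //.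
by rewrite size_XB1_exp leqNgt ki.
Qed.

Lemma lead_trinomial_gf n : (trinomial_gf n.+1)`_n = (T n)%:R.
Proof.
rewrite /trinomial_gf big_ord_recr coefD coef_sum big1 => [|k _].
  by rewrite add0r mulr_natl coefMn coef_XB1_exp subnn binn expr0 mulr1.
rewrite mulr_natl coefMn nth_default ?mul0rn //.
by rewrite size_XB1_exp /= ltn_ord.
Qed.

(* Without the factor [(2 * k).+1 * 'C(2 * k, k)] the recurrence read off
   [trinomial_gf_ode] requires dividing by [2k + 1], which vanishes mod [p] for
   [k = (p - 1)/2]. *)
Definition scaled_gf n k := ((2 * k).+1 * 'C(2 * k, k))%:R
  * (trinomial_gf n)`_k.

Lemma scaled_gf0 n : 2 * scaled_gf n.+1 0 =
  - (n.+1%:R * Y ^+ n * ((T n.+1)%:R + 3 * (T n)%:R * Y))`_0.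
Proof.
have := congr1 (coefp 0) (trinomial_gf_ode n).
rewrite /= -mulrA coefXM eqxx /= coefB.
have -> (q : {poly R}) : (3 * 'X - 2) * q = 'X * q *+ 3 - q *+ 2 by ring.
rewrite coefB !coefMn coefXM /= /scaled_gf muln0 bin0 mul1n mul1r.
move=> /esym/eqP; rewrite mul0rn sub0r -opprD oppr_eq0 addr_eq0.
by rewrite -[_ *+ 2]mulr_natl => /eqP.
Qed.

(** This is the coefficient of [w^(k+1)] in [trinomial_gf_ode] times ['C(2k+2, k+1)]; the scaling
    makes the homogeneous part constant. *)
Lemma scaled_gfS n k : 2 * scaled_gf n.+1 k.+1 = 6 * scaled_gf n.+1 k +
  - (n.+1%:R * Y ^+ n * ((T n.+1)%:R + 3 * (T n)%:R * Y))`_k.+1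
  * ('C(2 * k.+1, k.+1))%:R.
Proof.
set J := (n.+1%:R * _ * _ : {poly R})`_k.+1; set g := trinomial_gf n.+1.
have rec : (4 * k%:R + 6) * g`_k.+1 = 3 * (k%:R + 1) * g`_k - J.
  have := congr1 (coefp k.+1) (trinomial_gf_ode n); rewrite -/g /=.
  have -> : 'X * (4 - 3 * 'X) * g^`() = 'X * (g^`() *+ 4) - 'X * ('X
    * g^`()) *+ 3.
    by ring.
  have -> : (3 * 'X - 2) * g = 'X * g *+ 3 - g *+ 2 by ring.
  have coefXD q i : ('X * q^`())`_i = i%:R * q`_i :> R.
    by case: i => [|i]; rewrite coefXM ?mul0r //= coef_deriv mulr_natl.
  rewrite !coefB -/J !coefMn !(coefXM _ k.+1) /= coefXD coefMn coef_deriv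
    -[g`_k.+1 *+ _]mulr_natl.
  rewrite -[k.+1%:R]natr1 => h.
  move/eqP: h; rewrite -subr_eq0 => /eqP h.
  by apply: subr0_eq; rewrite -[RHS]h; ring.
have e1 : (2 * k.+1).+1%:R = 2 * k%:R + 3 :> R.
  by rewrite -natrM -natrD; congr (_%:R); lia.
rewrite /scaled_gf -/g !natrM e1.
transitivity (('C(2 * k.+1, k.+1))%:R * ((4 * k%:R + 6) * g`_k.+1));
  first by ring.
rewrite rec.
transitivity (3 * g`_k * (k.+1%:R * ('C(2 * k.+1, k.+1))%:R)
  - J * ('C(2 * k.+1, k.+1))%:R); first by rewrite -[k.+1%:R]natr1; ring.
by rewrite bin_centralS; ring.
Qed.

End TrinomialGF.

(** * Powers of [1 + sqrt d] *)

Section SqrtExpansion.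

Variable A : comNzRingType.
Implicit Type d : A.

(* [(1 + sqrt d) ^+ n = rat_part d n + irr_part d n * sqrt d] *)
Definition rat_part d n : A := (even_poly ((1 + 'X) ^+ n)).[d].
Definition irr_part d n : A := (odd_poly ((1 + 'X) ^+ n)).[d].

Lemma rat_part0 d : rat_part d 0 = 1.
Proof. by rewrite /rat_part expr0 even_polyC hornerC. Qed.

Lemma irr_part0 d : irr_part d 0 = 0.
Proof. by rewrite /irr_part expr0 odd_polyC horner0. Qed.

Lemma rat_partS d n : rat_part d n.+1 = rat_part d n + d * irr_part d n.
Proof.
rewrite /rat_part exprSr mulrDr mulr1 even_polyD even_polyMX.
by rewrite hornerD hornerMX [_ * d]mulrC.
Qed.

Lemma irr_partS d n : irr_part d n.+1 = irr_part d n + rat_part d n.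
Proof. by rewrite /irr_part exprSr mulrDr mulr1 odd_polyD odd_polyMX hornerD.
  Qed.

(** Compare irrational parts in [(1 - d) (1 + sqrt d)^n = (1 - sqrt d) (1 + sqrt d)^(n+1)]. *)
Lemma mul_1B_irr_part d n :
  (1 - d) * irr_part d n = irr_part d n.+1 - rat_part d n.+1.
Proof. by rewrite irr_partS rat_partS; ring. Qed.

Lemma rat_part9 n : 2 * rat_part 9 n = 4 ^+ n + (-2) ^+ n.
Proof.
suff [] : 2 * rat_part 9 n = 4 ^+ n + (-2) ^+ n
  /\ 6 * irr_part 9 n = 4 ^+ n - (-2) ^+ n by [].
elim: n => [|n [IHe IHo]]; first by rewrite rat_part0 irr_part0; split; ring.
rewrite rat_partS irr_partS !exprS; split.
  transitivity (2 * rat_part 9 n + 3 * (6 * irr_part 9 n)); first by ring.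
  by rewrite IHe IHo; ring.
transitivity (6 * irr_part 9 n + 3 * (2 * rat_part 9 n)); first by ring.
by rewrite IHe IHo; ring.
Qed.

(** [1 + sqrt (-3)] is twice a primitive sixth root of unity, so its cube is -8. *)
Lemma rat_part_N3 n :
  [/\ rat_part (-3) (3 * n) = (-8) ^+ n, irr_part (-3) (3 * n) = 0,
      rat_part (-3) (3 * n).+1 = (-8) ^+ n
    & rat_part (-3) (3 * n).+2 = - 2 * (-8) ^+ n].
Proof.
have [he ho] : rat_part (-3) (3 * n) = (-8) ^+ n /\ irr_part (-3) (3 * n) = 0.
  elim: n => [|n [IHe IHo]]; first by rewrite rat_part0 irr_part0.
  rewrite (_ : 3 * n.+1 = (3 * n).+3)%N; last by lia.
  by rewrite !(rat_partS, irr_partS) IHe IHo exprS; split; ring.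
by split; rewrite ?(rat_partS, irr_partS) ?he ?ho //; ring.
Qed.

(** Here [n] is 1 or 5 modulo 6, so the [n]th power of that root of unity has real part 1/2. *)
Lemma rat_part_N3_coprime6 n : odd n -> ~~ (3 %| n)%N ->
  rat_part (-3) n = 2 ^+ n.-1.
Proof.
move=> on n3; pose k := (n %/ 6)%N.
have e8 : (-8) ^+ (2 * k) = 2 ^+ (6 * k) :> A.
  by rewrite !exprM; congr (_ ^+ _); ring.
have [ek|ek] : n = (3 * (2 * k)).+1 \/ n = (3 * (2 * k).+1).+2.
- by move: n3; rewrite /dvdn /k; lia.
- have [_ _ h _] := rat_part_N3 (2 * k).
  by rewrite {1}ek h e8; congr (_ ^+ _); lia.
have [_ _ _ h] := rat_part_N3 (2 * k).+1.
rewrite {1}ek h exprS e8 (_ : n.-1 = 4 + 6 * k)%N; last by lia.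
by rewrite exprD; ring.
Qed.

End SqrtExpansion.

Section SqrtExpansionPoly.

Variable R : comNzRingType.
Implicit Type d : {poly R}.

Lemma horner_parts d x n :
  (rat_part d n).[x] = rat_part d.[x] n /\ (irr_part d n).[x]
    = irr_part d.[x] n.
Proof.
elim: n => [|n [IHe IHo]]; first by rewrite !rat_part0 !irr_part0 hornerC
  horner0.
by rewrite !rat_partS !irr_partS !hornerD hornerM IHe IHo.
Qed.

Lemma size_parts d n : (size d <= 2)%N ->
  (size (rat_part d n) <= n.-1.+1)%N /\ (size (irr_part d n) <= n)%N.
Proof.
move=> sd; elim: n => [|n [IHe IHo]].
  by rewrite rat_part0 irr_part0 size_poly1 size_poly0.
rewrite rat_partS irr_partS; split.
  apply: leq_trans (size_polyD _ _) _; rewrite geq_max; apply/andP; split.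
    by apply: leq_trans IHe _; case: (n).
  apply: leq_trans (size_polyMleq _ _) _; rewrite -subn1 leq_subLR add1n.
  exact: leq_add sd IHo.
apply: leq_trans (size_polyD _ _) _; rewrite geq_max; apply/andP; split.
  exact: leqW.
by apply: leq_trans IHe _; case: (n).
Qed.

(** Formally, [(1 + sqrt d)^(n+1)] has derivative [(n+1) (1 + sqrt d)^n c / sqrt d]; take rational
    parts. *)
Lemma deriv_rat_part d (c : R) n : d^`() = c%:P *+ 2 ->
  (rat_part d n.+1)^`() = c%:P * n.+1%:R * irr_part d n.
Proof.
move=> dd.
suff [] : (rat_part d n.+1)^`() = c%:P * n.+1%:R * irr_part d n /\
  (rat_part d n.+2)^`() = c%:P * n.+2%:R * irr_part d n.+1 by [].
elim: n => [|n [IH1 IH2]].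
  rewrite !(rat_partS, irr_partS, rat_part0, irr_part0) mulr0 addr0 add0r mulr1
    mulr1.
  by rewrite derivD derivC dd; split; ring.
split=> //.
(* [1 + sqrt d] has trace 2 and norm [1 - d]. The order-two recurrence is why the induction carries
   two consecutive cases. *)
have -> : rat_part d n.+3 = 2 * rat_part d n.+2 - (1 - d) * rat_part d n.+1.
  by rewrite !(rat_partS, irr_partS); ring.
rewrite mulrBl mul1r !(derivD, derivN, derivM) IH1 IH2 dd.
rewrite -[2]polyC_natr derivC polyC_natr.
rewrite !(irr_partS _ n.+1) !(irr_partS _ n) !(rat_partS _ n.+1) !(rat_partS _
  n).
rewrite -[n.+3%:R]natr1 -[n.+2%:R]natr1 -[n.+1%:R]natr1; ring.
Qed.

End SqrtExpansionPoly.

(** * Evaluation modulo [p ^ 2] *)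

(** Each coefficient of [trin * q] sums three consecutive coefficients of [q]; the blocks ending at
    [n-1], [n-4], ... tile the range below [n]. *)
Lemma sum_class3_trinM (R : comNzRingType) (q : {poly R}) n :
  \sum_(0 <= i < n | i.+1 == n %[mod 3]) (trin R * q)`_i =
  \sum_(0 <= i < n) q`_i.
Proof.
elim/ltn_ind: n => [] [|[|[|n]]] IHn; first by rewrite !big_geq.
- by rewrite big_mkcond !big_nat1 /= coef0_trinM.
- by rewrite big_mkcond !big_nat_recr //= !big_geq // !add0r coef1_trinM addrC.
rewrite big_mkcond !(big_nat_recr n.+2, big_nat_recr n.+1, big_nat_recr n) //=.
rewrite -{}IHn; last by lia.
rewrite [X in _ = X + _ + _ + _]big_mkcond /= eqxx coef_trinM.
rewrite (_ : (n.+1 == n.+3 %[mod 3]) = false); last by lia.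
rewrite (_ : (n.+2 == n.+3 %[mod 3]) = false); last by lia.
rewrite !addr0 -!addrA; congr (_ + _); last by ring.
Qed.

(** Evaluate at 1 and fold the coefficients above the centre onto those below. *)
Lemma horner1_trin_exp (R : comNzRingType) n :
  \sum_(0 <= i < n.+1) (trin R ^+ n)`_i + \sum_(0 <= i < n) (trin R ^+ n)`_i
  = 3 ^+ n.
Proof.
have -> : 3 = (trin R).[1].
  by rewrite !(hornerD, hornerX, hornerXn, hornerC) expr1n; ring.
rewrite -horner_exp (@horner_coef_wide _ (n + n.+1)); last first.
  by apply/leq_sizeP => j lej; apply: coef_trin_exp_gt; lia.
under [RHS]eq_bigr do rewrite expr1n mulr1.
rewrite -(big_mkord xpredT (fun i => (trin R ^+ n)`_i)) addnS -addSn.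
rewrite [RHS](big_cat_nat (n := n.+1)) ?leq_addr //=; congr (_ + _).
rewrite -[X in \sum_(X <= i < _ + _) _]add0n big_addn addKn big_nat_rev /=.
rewrite [LHS]big_nat [RHS]big_nat; apply: eq_bigr => i /andP[_ lti].
by apply: coef_trin_exp_sym; lia.
Qed.

Section ModPSquare.

Variables (R : comUnitRingType) (p : nat).
Hypotheses (p_prime : prime p) (p_gt3 : (3 < p)%N).
Hypothesis p_sqr0 : p%:R * p%:R = 0 :> R.
Hypothesis unit_nat : forall n, ~~ (p %| n)%N -> (n%:R : R) \is a GRing.unit.

Lemma unit_nat_lt n : (0 < n < p)%N -> (n%:R : R) \is a GRing.unit.
Proof.
by case/andP=> n0 np; apply: unit_nat; rewrite gtnNdvd.
Qed.

Lemma p_mul_bin k : (0 < k < p)%N -> p%:R * ('C(p, k))%:R = 0 :> R.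
Proof.
by move=> hk; have /dvdnP[c ->] := prime_dvd_bin p_prime hk;
  rewrite natrM mulrCA p_sqr0 mulr0.
Qed.

(** Congruences modulo [p] are stated as equations multiplied by [p]; this one is the additivity of
    Frobenius. The morphism [f] carries [p_mul_bin] to rings such as polynomials over [R]. *)
Lemma p_mul_exprD (A : comNzRingType) (f : {rmorphism R -> A}) (a b : A) :
  p%:R * (a + b) ^+ p = p%:R * (a ^+ p + b ^+ p).
Proof.
rewrite exprDn -(big_mkord xpredT (fun i => a ^+ (p - i) * b ^+ i *+ 'C(p, i))).
rewrite big_nat_recr //= big_ltn ?prime_gt0 //.
rewrite subn0 expr0 mulr1 bin0 subnn expr0 mul1r binn !mulr1n !mulrDr.
rewrite mulr_sumr big_nat big1 ?addr0 // => i hi.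
rewrite -[_ *+ 'C(_, _)]mulr_natr mulrCA.
by rewrite -(rmorph_nat f p) -(rmorph_nat f 'C(_, _)) -rmorphM p_mul_bin
  // rmorph0 mulr0.
Qed.

(** * The values [T (p-1)] and [T p] from sums over residue classes mod 3 *)

Let F := trin R ^+ p.
Let t := trin R ^+ p.-1.

Lemma trin_expp : F = trin R * t.
Proof. by rewrite /F /t -exprS prednK ?prime_gt0. Qed.

Lemma pM_coef_trin_expp i : (0 < i < p)%N -> p%:R * F`_i = 0.
Proof.
move=> hi; have -> : p%:R * F`_i = (p%:R * F)`_i.
  by rewrite -[p%:R in RHS]polyC_natr coefCM.
rewrite /F /trin !(p_mul_exprD polyC) mulrDr (p_mul_exprD polyC).
rewrite expr1n -exprM -[p%:R]polyC_natr !(coefD, coefCM, coefXn, coef1).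
have [-> -> ->] : [/\ (i == p) = false, (i == 0)%N = false & (i == 2 * p)%N
  = false].
  by split; lia.
by rewrite addr0 mulr0 addr0.
Qed.

(** Modulo [p] and below degree [p], [t] agrees with [1 / (1 + x + x^2) = (1 - x) / (1 - x^3)]. *)
Lemma pM_coef_trin_exp_pred i : (i < p)%N ->
  p%:R * t`_i = p%:R * (if (i %% 3 == 0)%N then 1 else if (i %% 3 == 1)%N then
    -1 else 0).
Proof.
elim/ltn_ind: i => [] [|[|i]] IHi lti; first by rewrite coef0_trin_exp.
  rewrite coef1_trin_exp -subn1 natrB ?prime_gt0 //= mulrBr p_sqr0 sub0r.
  by rewrite mulrN mulr1.
have := pM_coef_trin_expp (i := i.+2) lti.
rewrite trin_expp coef_trinM !mulrDr.
rewrite (IHi i) ?(IHi i.+1); try lia.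
move/eqP; rewrite -addrA addr_eq0 => /eqP ->.
have : (i %% 3 < 3)%N by rewrite ltn_mod.
have [-> ->] : (i.+1 %% 3 = (i %% 3).+1 %% 3 /\ i.+2 %% 3 = (i %% 3).+2 %% 3)%N.
  by lia.
by case: (i %% 3)%N => [|[|[|]]] //= _; ring.
Qed.

(** From [F' = p (1 + 2x) t], where the factor [p] means that [t] matters only modulo [p]. *)
Lemma coef_trin_expp i : (0 < i < p)%N ->
  i%:R * F`_i = p%:R * (if (i %% 3 == 0)%N then -2 else 1).
Proof.
case: i => [|[|i]] // hi; first by rewrite coef1_trin_exp mul1r mulr1.
have := coef_trin_exp_deriv R p.-1 i.
rewrite prednK ?prime_gt0 // -/t -/F.
rewrite -[_ *+ i.+2]mulr_natl -[_ *+ p]mulr_natl -[_ *+ 2]mulr_natl => ->.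
rewrite mulrDr mulrCA !pM_coef_trin_exp_pred; try lia.
have : (i %% 3 < 3)%N by rewrite ltn_mod.
have [-> ->] : (i.+1 %% 3 = (i %% 3).+1 %% 3 /\ i.+2 %% 3 = (i %% 3).+2 %% 3)%N.
  by lia.
by case: (i %% 3)%N => [|[|[|]]] //= _; ring.
Qed.

(** On coefficients killed by [p], the factor [p - i] acts as [-i]; cross-multiply [coef_trin_expp]
    at [i] and [p - i]. *)
Lemma coef_trin_expp_sub i : (0 < i < p)%N ->
  (if (i %% 3 == 0)%N then -2 else 1) * F`_(p - i) =
  - (if ((p - i) %% 3 == 0)%N then -2 else 1) * F`_i.
Proof.
move=> hi; have hpi : (0 < p - i < p)%N by lia.
apply: (mulrI (unit_nat_lt hi)).
have -> : forall c, i%:R * (c * F`_(p - i)) = - (c * ((p - i)%:R * F`_(p - i))).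
  move=> c; rewrite natrB; last by lia.
  by rewrite mulrBl pM_coef_trin_expp //; ring.
by rewrite [in RHS]mulrCA !coef_trin_expp //; ring.
Qed.

Lemma p_mod3 : (p %% 3 = 1 \/ p %% 3 = 2)%N.
Proof.
suff : ~~ (3 %| p)%N by rewrite /dvdn; have := ltn_pmod p (isT : 0 < 3)%N; lia.
by rewrite dvdn_prime2 //; lia.
Qed.

Lemma sum_class3_rev (f g : nat -> R) r s :
  (r + s = p %[mod 3])%N ->
  (forall i, (0 < i < p)%N -> i = r %[mod 3] -> f i = g (p - i)%N) ->
  \sum_(1 <= i < p | i == r %[mod 3]) f i = \sum_(1 <= i < p | i == s %[mod 3])
    g i.
Proof.
move=> rs fg; rewrite [RHS]big_nat_rev /= add1n.
rewrite big_nat_cond [RHS]big_nat_cond.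
apply: eq_big => [i|i /andP[hi /eqP ir]]; last by rewrite subSS fg.
by case: (boolP (0 < i < p)%N) => //= hi; apply/eqP/eqP; lia.
Qed.

Lemma two_unit : (2 : R) \is a GRing.unit.
Proof. by apply: (unit_nat_lt (n := 2)); lia. Qed.

Lemma four_unit : (4 : R) \is a GRing.unit.
Proof. by rewrite (_ : 4 = 2 ^+ 2) ?unitrX ?two_unit //; ring. Qed.

(* The terms cancel in pairs under [i |-> p - i]. *)
Lemma sum_class3_self r : (r + r = p %[mod 3])%N ->
  \sum_(1 <= i < p | i == r %[mod 3]) F`_i = 0.
Proof.
move=> rr; set S := \sum_(_ <= i < _ | _) _.
suff SN : S = - S.
  by apply: (mulrI two_unit); rewrite mulr0 mulr_natl mulr2n {1}SN addNr.
rewrite /S -sumrN; apply: (sum_class3_rev rr) => i hi ir.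
have := coef_trin_expp_sub hi; have := p_mod3 => p3.
rewrite !ifF; [|by apply/eqP; lia..].
by rewrite mul1r mulN1r => ->; rewrite opprK.
Qed.

Lemma sum_class3_0p :
  \sum_(1 <= i < p | i == 0 %[mod 3]) F`_i =
  2 * \sum_(1 <= i < p | i == p %[mod 3]) F`_i.
Proof.
rewrite mulr_sumr; apply: sum_class3_rev => // i hi i0.
have := coef_trin_expp_sub hi; have := p_mod3 => p3.
rewrite ifT; last by apply/eqP; lia.
rewrite ifF; last by apply/eqP; lia.
by rewrite mulN1r mulNr => /oppr_inj ->.
Qed.

Definition eps : R := if (p %% 3 == 1)%N then 1 else -1.

Let theta n := \sum_(0 <= i < n) t`_i.

Lemma thetaS n : theta n.+1 = theta n + t`_n.
Proof. by rewrite /theta big_nat_recr. Qed.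

Lemma theta_class n : (0 < n)%N -> theta n =
  (if (n == 1 %[mod 3])%N then 1 else 0) + \sum_(1 <= i < n | i.+1 == n %[mod
    3]) F`_i.
Proof.
move=> n0; rewrite /theta -sum_class3_trinM -trin_expp big_mkcond big_ltn //=.
rewrite -big_mkcond eq_sym; congr (_ + _).
by case: ifP; rewrite // coef0_trin_exp.
Qed.

(** For [n] among [p-2], [p-1], [p], no index from [n] to [p-1] lies in the class of [r], so the
    three sums share one range. *)
Lemma theta_class_p n r : (0 < n <= p)%N -> (p <= n.+2)%N ->
    (n = r.+1 %[mod 3])%N ->
  theta n = (if (r == 0 %[mod 3])%N then 1 else 0) +
    \sum_(1 <= i < p | i == r %[mod 3]) F`_i.
Proof.
case/andP=> n0 np pn nr; rewrite theta_class //; congr (_ + _).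
  by congr (if _ then _ else _); apply/eqP/eqP; lia.
rewrite [RHS](big_cat_nat (n := n)) //= [X in _ + X]big_nat_cond.
rewrite [X in _ + X]big1 => [|i]; last first.
  by case/andP=> /andP[ni ip] /eqP ir; lia.
by rewrite addr0; apply: eq_bigl => i; apply/eqP/eqP; lia.
Qed.

Lemma theta_p : theta p = theta p.-1 + t`_p.-1.
Proof. by rewrite -thetaS prednK ?prime_gt0. Qed.

Lemma theta_p1 : theta p.-1 = theta p.-2 + t`_p.-2.
Proof. by rewrite -thetaS (_ : p.-2.+1 = p.-1) //; lia. Qed.

Lemma theta_sum : theta p + theta p.-1 = 3 ^+ p.-1.
Proof. by rewrite -horner1_trin_exp prednK ?prime_gt0. Qed.

Lemma coef_F_p : F`_p = t`_p.-1 + 2 * t`_p.-2.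
Proof.
have p2 : p.-2.+2 = p by lia.
rewrite trin_expp -[X in _`_X]p2 coef_trinM (coef_trin_exp_sym _ (j := p.-2));
  last by lia.
by rewrite (_ : p.-2.+1 = p.-1); [ring | lia].
Qed.

(** Both are combinations of [theta] at [p], [p-1], [p-2]. One class sum vanishes, another is twice
    the third, and [theta_sum] brings in [3 ^+ p.-1]. *)
Lemma coef_trin_middle : t`_p.-1 = eps * 3 ^+ p.-1 /\ F`_p = 1.
Proof.
rewrite coef_F_p -theta_sum /eps.
have e1 : t`_p.-1 = theta p - theta p.-1 by rewrite theta_p addrAC subrr add0r.
have e2 : t`_p.-2 = theta p.-1 - theta p.-2 by rewrite theta_p1 addrAC subrr
  add0r.
have := sum_class3_0p; case: p_mod3 => p3.
  rewrite ifT; last by apply/eqP.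
  rewrite e1 e2 (@theta_class_p p 0) ?leqnn ?prime_gt0 //; [|lia..].
  rewrite (@theta_class_p p.-1 2); [|lia..].
  rewrite (@theta_class_p p.-2 p); [|lia..].
  rewrite (@sum_class3_self 2) => [->|]; last by lia.
  rewrite (_ : (2 == 0 %[mod 3])%N = false) //= (_ : (p == 0 %[mod 3])%N
    = false); last by apply/eqP; lia.
  by split; ring.
rewrite ifF; last by apply/eqP; lia.
rewrite e1 e2 (@theta_class_p p 1) ?leqnn ?prime_gt0 //; [|lia..].
rewrite (@theta_class_p p.-1 0); [|lia..].
rewrite (@theta_class_p p.-2 p); [|lia..].
rewrite (@sum_class3_self 1) => [->|]; last by lia.
rewrite (_ : (1 == 0 %[mod 3])%N = false) //= (_ : (p == 0 %[mod 3])%N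
  = false); last by apply/eqP; lia.
by split; ring.
Qed.

Lemma trinomial_pred_p : (trinomial_nat p.-1)%:R = eps * 3 ^+ p.-1 :> R.
Proof. by rewrite -coef_trin_trinomial (proj1 coef_trin_middle). Qed.

Lemma trinomial_p : (trinomial_nat p)%:R = 1 :> R.
Proof. by rewrite -coef_trin_trinomial (proj2 coef_trin_middle). Qed.

Lemma eps_sqr : eps * eps = 1.
Proof. by rewrite /eps; case: ifP => _; ring. Qed.

(** * Congruences modulo [p], carried by a factor [p] *)

Lemma pM_exp_pred a : ~~ (p %| a)%N -> p%:R * a%:R ^+ p.-1 = p%:R :> R.
Proof.
move=> pa; apply: (mulIr (unit_nat pa)).
rewrite -mulrA -exprSr prednK ?prime_gt0 // -natrX -!natrM.
rewrite (divn_eq (p * a ^ p) (p * p)) (divn_eq (p * a) (p * p)) -!muln_modr.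
by rewrite fermat_little // !natrD !natrM p_sqr0 !mulr0.
Qed.

Lemma pM_bin_pred k : (k < p)%N ->
  p%:R * ('C(p.-1, k))%:R = p%:R * (-1) ^+ k :> R.
Proof.
elim: k => [|k IHk] hk; first by rewrite bin0.
have := @p_mul_bin k.+1 hk.
rewrite -{2}(prednK (prime_gt0 p_prime)) binS natrD mulrDr => /eqP.
by rewrite addr_eq0 => /eqP ->; rewrite IHk 1?ltnW // exprS; ring.
Qed.

Lemma p_odd : odd p.
Proof. by case/even_prime: p_prime => // p2; move: p_gt3; rewrite p2. Qed.

(** Modulo [p], [(x - 1)^(p-1) = (x^p - 1) / (x - 1)]. *)
Lemma pM_coef_XB1 k : (k < p)%N -> p%:R * (('X - 1 : {poly R}) ^+ p.-1)`_k
  = p%:R.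
Proof.
move=> hk; rewrite coef_XB1_exp mulrCA pM_bin_pred // mulrCA -exprD subnK;
  last by lia.
by rewrite -signr_odd (_ : odd p.-1 = false) ?mulr1 //; have := p_odd; lia.
Qed.

(* [(1 - 4x)^((p-1)/2)] and [(1 - 4x)^(-1/2)] agree modulo [p] up to [x^(p-1)].
  *)
Lemma pM_bin_central k : (k < p)%N ->
  p%:R * ('C(2 * k, k))%:R = p%:R * ((-4) ^+ k * ('C(p./2, k))%:R) :> R.
Proof.
have p_half : p%:R * (2 * (p./2)%:R + 1) = 0 :> R.
  have -> : 2 * (p./2)%:R + 1 = p%:R :> R; last exact: p_sqr0.
  by rewrite -natrM natr1; congr (_%:R); have := p_odd; lia.
elim: k => [|k IHk] hk; first by rewrite !bin0 expr0 mul1r.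
apply: (mulrI (unit_nat_lt (n := k.+1) hk)).
have -> : k.+1%:R * (p%:R * ('C(2 * k.+1, k.+1))%:R) =
    2 * (2 * k).+1%:R * (p%:R * ('C(2 * k, k))%:R) :> R.
  by rewrite mulrCA bin_centralS; ring.
have -> : k.+1%:R * (p%:R * ((-4) ^+ k.+1 * ('C(p./2, k.+1))%:R)) =
    (-4) ^+ k.+1 * (p%:R * (k.+1%:R * ('C(p./2, k.+1))%:R)) :> R by ring.
have -> : k.+1%:R * ('C(p./2, k.+1))%:R = ((p./2)%:R - k%:R)
  * ('C(p./2, k))%:R :> R.
  rewrite -natrM mul_bin_left natrM.
  have [kp|pk] := leqP k p./2; first by rewrite natrB.
  by rewrite bin_small // !mulr0.
rewrite (IHk (ltnW hk)) -[(2 * k).+1%:R]natr1 natrM exprS; apply: subr0_eq.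
transitivity (2 * (-4) ^+ k * ('C(p./2, k))%:R * (p%:R * (2 * (p./2)%:R
  + 1)) : R).
  by ring.
by rewrite p_half mulr0.
Qed.

Lemma pM_exp3_pred : p%:R * 3 ^+ p.-1 = p%:R :> R.
Proof. by apply: (@pM_exp_pred 3); rewrite dvdn_prime2 //;
  case: eqP p_gt3 => // ->. Qed.

(* Avoids quadratic reciprocity: both sides equal [p * T (p-1)]. *)
Lemma pM_eps : p%:R * eps = p%:R * (-3) ^+ p./2 :> R.
Proof.
have p1 := prednK (prime_gt0 p_prime).
transitivity (p%:R * (trinomial_nat p.-1)%:R : R).
  by rewrite trinomial_pred_p mulrCA pM_exp3_pred mulrC.
(* Modulo [p] all [w]-coefficients of [z^(p-1)] are 1, so [T (p-1)] is a sum of central binomials,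
   that is, the expansion of [(1 - 4)^((p-1)/2)]. *)
rewrite -sum_XB1_binom mulr_sumr p1.
under eq_bigr => k _ do rewrite mulrA pM_coef_XB1 // pM_bin_central //.
have -> : -3 = 1 + -4 :> R by ring.
rewrite exprDn -mulr_sumr; congr (_ * _).
rewrite (big_ord_widen p (fun k => 1 ^+ (p./2 - k)
  * (-4) ^+ k *+ 'C(p./2, k))); last first.
  by have := p_gt3; lia.
rewrite [RHS]big_mkcond; apply: eq_bigr => k _ /=.
case: ifP => hk; first by rewrite expr1n mul1r mulr_natr.
by rewrite bin_small ?mulr0 //; lia.
Qed.

Lemma trinomial_p1 : (trinomial_nat p.+1)%:R = 1 + p%:R * (1 + 3 * eps) :> R.
Proof.
have p1 := prednK (prime_gt0 p_prime).
have := trinomial_rec R p.-1; rewrite p1 trinomial_p trinomial_pred_p.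
have -> : p.-1%:R = p%:R - 1 :> R by rewrite -[in RHS]p1 -natr1 addrK.
move=> h; apply: (mulrI (unit_nat (n := p.+1) _)).
  by rewrite -addn1 dvdn_addr ?dvdnn // dvdn1; case: eqP p_gt3 => // ->.
rewrite -[p.+1%:R]natr1.
transitivity ((p%:R - 1 + 2) * (trinomial_nat p.+1)%:R : R); first by ring.
rewrite h.
transitivity (2 * p%:R + 1 + 3 * eps * (p%:R * 3 ^+ p.-1) : R); first by ring.
rewrite pM_exp3_pred; apply: subr0_eq.
transitivity (- (p%:R * p%:R) * (1 + 3 * eps) : R); first by ring.
by rewrite p_sqr0 oppr0 mul0r.
Qed.

(** Split [(1 + x)^p = 1 + x^p] modulo [p] by parity, [p] being odd. *)
Lemma pM_parts (A : comNzRingType) (f : {rmorphism R -> A}) (d : A) :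
  p%:R * rat_part d p = p%:R /\ p%:R * irr_part d p = p%:R * d ^+ p./2.
Proof.
have frob : p%:R *: (1 + 'X : {poly A}) ^+ p = p%:R *: (1 + 'X^p).
  rewrite -!mul_polyC polyC_natr.
  by rewrite (p_mul_exprD (polyC \o f : {rmorphism R -> _})) expr1n.
have evenX : even_poly 'X^p = 0 :> {poly A}.
  apply/polyP => i; rewrite coef_even_poly coefXn coef0.
  by case: eqP => // e; have := p_odd; rewrite -e odd_double.
have oddX : odd_poly 'X^p = 'X^(p./2) :> {poly A}.
  apply/polyP => i; rewrite coef_odd_poly !coefXn; congr (_%:R);
    congr nat_of_bool.
  by have := p_odd; apply: contraTeq; lia.
split; rewrite /rat_part /irr_part -!hornerZ -?even_polyZ -?odd_polyZ frob.
  by rewrite even_polyZ even_polyD evenX even_polyC addr0 hornerZ hornerC mulr1.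
by rewrite odd_polyZ odd_polyD oddX odd_polyC add0r !hornerZ hornerXn.
Qed.

(** Since [d = -3 (1 - 4x)], [d^((p-1)/2)] is modulo [p] [eps] times the generating polynomial of
    the central binomials, while [1 - d = 4 (1 - 3x)] fits the recurrence of [scaled_gf]. *)
Let d : {poly R} := 12 * 'X - 3.
Let V := rat_part d p.

Lemma horner_d x : d.[x] = 12 * x - 3.
Proof.
by rewrite /d mulr_natl hornerD hornerN hornerMn hornerX -polyC_natr hornerC
  mulr_natl.
Qed.

(* [4(1 - 3x) V' = 6p (e (1 - 4x)^((p-1)/2) - 1)], read coefficientwise. *)
Lemma coef_V n : (n < p)%N ->
  4 * (n.+1%:R * V`_n.+1) =
  12 * (n%:R * V`_n) + 6 * p%:R * (eps * ('C(2 * n, n))%:R - (n == 0)%:R).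
Proof.
move=> np.
have dd : d^`() = 6%:P *+ 2.
  by rewrite /d derivB mulr_natl derivMn derivX -[3]polyC_natr derivC subr0
    polyC_natr; ring.
have [pe po] := pM_parts polyC d.
have eps_poly : p%:R * eps%:P = p%:R * (-3) ^+ p./2 :> {poly R}.
  have := congr1 polyC pM_eps.
  by rewrite !polyCM rmorphXn rmorphN /= !polyC_natr.
have eqV : V^`() *+ 4 - 'X * V^`() *+ 12 =
    (6 * p%:R)%:P * (eps%:P * (1 + (-4)%:P * 'X) ^+ p./2 - 1).
  transitivity ((1 - d) * V^`()); first by rewrite /d; ring.
  rewrite /V -{1}(prednK (prime_gt0 p_prime)) (deriv_rat_part _ dd).
  rewrite prednK ?prime_gt0 // mulrCA mul_1B_irr_part prednK ?prime_gt0 //.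
  transitivity (6%:P * (p%:R * irr_part d p - p%:R * rat_part d p) : {poly R}).
    by ring.
  have -> : (6 * p%:R)%:P * (eps%:P * (1 + (-4)%:P * 'X) ^+ p./2 - 1) =
      6%:P * (p%:R * eps%:P * (1 + (-4)%:P * 'X) ^+ p./2 - p%:R) :> {poly R}.
    by rewrite polyCM polyC_natr; ring.
  rewrite po pe eps_poly -mulrA -exprMn; congr (_ * (_ * _ ^+ _ - _)).
  by rewrite /d rmorphN /= polyC_natr; ring.
have := congr1 (coefp n) eqV; rewrite /= coefB !coefMn coefXM coefCM coefB
  coef1.
rewrite coefCM coef_1DcX_exp.
have -> : (if n == 0 then 0 else (V^`())`_n.-1) = n%:R * V`_n.
  by case: (n) => [|k] /=; rewrite ?mul0r // coef_deriv mulr_natl.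
rewrite coef_deriv -[V`_n.+1 *+ _]mulr_natl => /eqP; rewrite subr_eq => /eqP h.
rewrite mulr_natl h -mulrA mulrBr [p%:R * (eps * _)]mulrCA -pM_bin_central
  // mulrCA.
by ring.
Qed.

Let B k := scaled_gf R p k.

(** Modulo [p], [(x - 1)^p = x^p - 1], so below degree [p] the [eps] term affects the constant
    coefficient only. *)
Lemma pM_coef_ode k : (k < p)%N ->
  (p.-1.+1%:R * ('X - 1 : {poly R}) ^+ p.-1 * ((trinomial_nat p.-1.+1)%:R
     + 3 * (trinomial_nat p.-1)%:R * ('X - 1)))`_k =
  p%:R * (1 - (if k == 0%N then 3 * eps else 0)).
Proof.
move=> kp; have p1 := prednK (prime_gt0 p_prime).
have -> : (trinomial_nat p.-1)%:R = (eps * 3 ^+ p.-1)%:P :> {poly R}.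
  by rewrite -trinomial_pred_p polyC_natr.
have -> : (trinomial_nat p.-1.+1)%:R = 1 :> {poly R}.
  by rewrite p1 -polyC_natr trinomial_p.
rewrite p1; set W := ('X - 1 : {poly R}) ^+ p.-1.
have -> : p%:R * W * (1 + 3 * (eps * 3 ^+ p.-1)%:P * ('X - 1)) =
    p%:R%:P * (W - (3 * eps * 3 ^+ p.-1)%:P * W + (3 * eps * 3 ^+ p.-1)%:P
      * ('X * W)).
  by rewrite -[3 * eps * _]mulrA [in RHS](polyCM 3) !polyC_natr; ring.
have cW i : (i < p)%N -> p%:R * (3 * eps * 3 ^+ p.-1 * W`_i) = p%:R * (3 * eps).
  move=> ip; transitivity (3 * eps * 3 ^+ p.-1 * (p%:R * W`_i)); first by ring.
  rewrite pM_coef_XB1 //; transitivity (3 * eps * (p%:R * 3 ^+ p.-1));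
    first by ring.
  by rewrite pM_exp3_pred mulrC.
rewrite coefCM coefD coefB !coefCM coefXM mulrDr mulrBr cW // pM_coef_XB1 //.
case: k kp => [|k] kp /=; first by ring.
by rewrite cW 1?ltnW //; ring.
Qed.

(** Both sides obey one first-order recurrence; the geometric term solves its homogeneous part and
    absorbs the exceptional [n == 0] term of [coef_V]. *)
Lemma scaled_gf_eq k : (k < p.-1)%N ->
  3 * eps * B k = 3 * p%:R * 3 ^+ k - k.+1%:R * V`_k.+1.
Proof.
have p1 := prednK (prime_gt0 p_prime).
elim: k => [|k IHk] hk; apply: (mulrI four_unit).
  have kp : (0 < p)%N by rewrite prime_gt0.
  rewrite mulrBr coef_V // muln0 bin0 mul0r mulr0.
  transitivity (6 * eps * (2 * B 0)); first by ring.
  rewrite /B -p1 scaled_gf0 pM_coef_ode //= p1.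
  transitivity (6 * p%:R * (3 * (eps * eps) - eps)); first by ring.
  by rewrite eps_sqr; ring.
have kp : (k.+1 < p)%N by lia.
rewrite mulrBr coef_V //.
transitivity (6 * eps * (2 * B k.+1)); first by ring.
have -> : 2 * B k.+1 = 6 * B k - p%:R * ('C(2 * k.+1, k.+1))%:R.
  by rewrite /B -{1 2}p1 scaled_gfS pM_coef_ode //= p1 subr0 mulr1 mulNr.
transitivity (12 * (3 * eps * B k) - 6 * p%:R * (eps * ('C(2
  * k.+1, k.+1))%:R)).
  by ring.
by rewrite IHk 1?ltnW // exprS /=; ring.
Qed.

Lemma V_at_0 : V`_0 = 2 ^+ p.-1.
Proof.
have pn3 : ~~ (3 %| p)%N by rewrite dvdn_prime2 // neq_ltn p_gt3.
rewrite -horner_coef0 (proj1 (horner_parts _ _ _)) -(rat_part_N3_coprime6 _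
  p_odd pn3).
by congr (rat_part _ p); rewrite horner_d; ring.
Qed.

Lemma V_at_1 : 2 * V.[1] = 4 ^+ p + (-2) ^+ p.
Proof.
rewrite (proj1 (horner_parts _ _ _)) -rat_part9; congr (_ * rat_part _ p).
by rewrite horner_d; ring.
Qed.

Lemma sum_V : \sum_(k < p.-1) V`_k.+1 = 2 ^+ p - 2.
Proof.
have p1 := prednK (prime_gt0 p_prime).
have sV : (size V <= p)%N.
  rewrite -[X in (_ <= X)%N]p1; apply: (proj1 (size_parts p _)).
  apply/leq_sizeP => j j2; rewrite /d coefB mulr_natl coefMn coefX.
  by rewrite -[3]polyC_natr coefC; case: j j2 => [|[|j]] //;
    rewrite mul0rn subr0.
have -> : \sum_(k < p.-1) V`_k.+1 = V.[1] - V`_0.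
  rewrite (horner_coef_wide _ sV).
  under [X in _ = X - _]eq_bigr do rewrite expr1n mulr1.
  by rewrite -[in RHS]p1 big_ord_recl addrAC subrr add0r.
apply: (mulrI two_unit); rewrite mulrBr V_at_1 V_at_0 -exprS p1.
(* As [2^p - 2] is a multiple of [p], the factor [2^p] beside it may be replaced by 2. *)
have [c c2] : exists c : R, 2 ^+ p - 2 = p%:R * c.
  have := fermat_little 2 p_prime => /eqP.
  rewrite eqn_mod_dvd; last by rewrite -{1}(expn1 2) leq_exp2l // prime_gt0.
  case/dvdnP => c e; exists c%:R; rewrite mulrC -natrM -e natrB ?natrX //.
  by rewrite -{1}(expn1 2) leq_exp2l // prime_gt0.
transitivity (2 ^+ p * (2 ^+ p - 2) : R).
  rewrite (_ : 4 = 2 * 2 :> R) ?exprMn; last by ring.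
  by rewrite exprNn -signr_odd p_odd; ring.
rewrite c2 -{1}p1 exprS.
transitivity (2 * c * (p%:R * 2 ^+ p.-1)); first by ring.
by rewrite (@pM_exp_pred 2) ?gtnNdvd ?(ltnW p_gt3) //; ring.
Qed.

(** By Vandermonde ['C(2p, p)] is the sum of the ['C(p, i)^2], whose inner terms are divisible by
    [p^2]. *)
Lemma bin_2p_pred : ('C((2 * p.-1).+1, p.-1))%:R = 1 :> R.
Proof.
have p1 := prednK (prime_gt0 p_prime).
apply: (mulrI two_unit); rewrite mulr1.
have -> : 2 * ('C((2 * p.-1).+1, p.-1))%:R = ('C(p + p, p))%:R :> R.
  rewrite -natrM; congr (_%:R).
  rewrite (_ : p + p = (2 * p.-1).+2)%N; last by lia.
  rewrite -{4}p1 binS -(bin_sub (m := p.-1.+1)); last by lia.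
  by rewrite (_ : (2 * p.-1).+1 - p.-1.+1 = p.-1)%N ?addnn ?mul2n //; lia.
rewrite -binomial.Vandermonde natr_sum -(big_mkord xpredT (fun i => ('C(p, i)
  * 'C(p, p - i))%:R)).
rewrite big_nat_recr //= big_ltn ?prime_gt0 // big_nat big1 => [|i ip].
  by rewrite subn0 subnn !binn !bin0 addr0.
by have /dvdnP[a ea] := prime_dvd_bin p_prime ip;
  rewrite bin_sub ?(ltnW (proj2 (andP ip))) // natrM ea natrM mulrACA p_sqr0
    mulr0.
Qed.

Lemma sum_binN3 : \sum_(k < p.-1) (-3) ^+ k.+1 * ('C(p, k.+1))%:R = 3 ^+ p
  - 2 ^+ p - 1 :> R.
Proof.
have p1 := prednK (prime_gt0 p_prime).
have : (1 + -3) ^+ p = \sum_(0 <= i < p.+1) (-3) ^+ i * ('C(p, i))%:R :> R.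
  rewrite exprDn big_mkord; apply: eq_bigr => i _.
  by rewrite expr1n mul1r mulr_natr.
rewrite big_nat_recl // -[X in \sum_(_ <= _ < X) _]p1 big_nat_recr //=
  big_mkord p1.
rewrite bin0 binn expr0 !mulr1 => h.
have neg x : (- x) ^+ p = - x ^+ p :> R by rewrite exprNn -signr_odd p_odd
  mulN1r.
have e : 1 + -3 = - 2 :> R by ring.
move: h; rewrite e !neg => h; apply: subr0_eq.
move/eqP: h; rewrite eq_sym -subr_eq0 => /eqP h; rewrite -[RHS]h; ring.
Qed.

Lemma sum_trinomial_mul_next :
  \sum_(k < p) (trinomial_nat k)%:R * ((trinomial_nat k)%:R
    + (trinomial_nat k.+1)%:R)
  = 2 * eps :> R.
Proof.
have p1 := prednK (prime_gt0 p_prime).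
have u3 : (3 : R) \is a GRing.unit by apply: unit_nat_lt.
rewrite -sum_trinomial_gf; congr (_ * _).
apply: (mulrI u3).
set S := \sum_(k < p) _.
suff h : 3 * eps * S = 3.
  transitivity (eps * eps * (3 * S)); first by rewrite eps_sqr mul1r.
  by rewrite -[in RHS]h; ring.
rewrite /S.
(* The term [k = p - 1] is split off because [term] cancels [k + 1], which must be a unit. *)
rewrite -(big_mkord xpredT (fun k => (trinomial_gf R p)`_k * ('C((2
  * k).+1, k))%:R)).
rewrite -[X in \sum_(_ <= _ < X) _]p1 big_nat_recr //= big_mkord bin_2p_pred
  mulr1.
have -> : (trinomial_gf R p)`_p.-1 = eps * 3 ^+ p.-1.
  by rewrite -trinomial_pred_p -lead_trinomial_gf p1.
rewrite mulrDr mulr_sumr.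
have term (k : 'I_p.-1) : 3 * eps * ((trinomial_gf R p)`_k * ('C((2
  * k).+1, k))%:R) =
    - (-3) ^+ k.+1 * ('C(p, k.+1))%:R - V`_k.+1.
  have kp := ltn_ord k; have kp' : (k.+1 < p)%N by lia.
  apply: (mulrI (unit_nat_lt (n := k.+1) kp')); rewrite mulrBr.
  transitivity (3 * eps * B k).
    rewrite /B /scaled_gf natrM.
    have <- : k.+1%:R * ('C((2 * k).+1, k))%:R = (2 * k).+1%:R * ('C(2
      * k, k))%:R :> R.
      rewrite -!natrM; congr (_%:R); have /= -> := mul_bin_down (2 * k).+1 k.
      by congr (_ * _)%N; lia.
    by ring.
  rewrite scaled_gf_eq //; congr (_ - _).
  (* [p (-1)^k = p 'C(p-1, k) = (k+1) 'C(p, k+1)] makes the geometric term a binomial one. *)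
  have -> : k.+1%:R * (- (-3) ^+ k.+1 * ('C(p, k.+1))%:R) =
      - (-3) ^+ k.+1 * (p%:R * (-1) ^+ k) :> R.
    rewrite mulrCA -pM_bin_pred 1?ltnW //; congr (_ * _).
    by rewrite -!natrM mul_bin_diag.
  have -> : -3 = -1 * 3 :> R by ring.
  rewrite exprMn !exprS.
  transitivity (3 * p%:R * 3 ^+ k * ((-1) ^+ k * (-1) ^+ k) : R); last by ring.
  by rewrite -expr2 sqrr_sign mulr1.
under eq_bigr => k _ do rewrite term.
rewrite sumrB sum_V.
under eq_bigr => k _ do rewrite mulNr.
rewrite sumrN sum_binN3.
have -> : 3 * eps * (eps * 3 ^+ p.-1) = 3 ^+ p :> R.
  by rewrite -[in RHS]p1 exprS mulrA -(mulrA 3) eps_sqr mulr1.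
by ring.
Qed.

(** * The three sums in a ring where [p^2 = 0] *)

Lemma sum_motzkin_sqr_modp2 :
  \sum_(k < p) (motzkin_nat k)%:R ^+ 2 = eps * (2 - 6 * p%:R).
Proof.
apply: (mulrI four_unit); rewrite sum_motzkin_sqr.
rewrite sum_trinomial_mul_next trinomial_p1 trinomial_p.
have x0 := p_sqr0; apply: subr0_eq; set x := p%:R in x0 *.
transitivity (x * x * (3 * (1 + 3 * eps) ^+ 2 - 8 * (1 + 3 * eps)
   + 2 * x * (1 + 3 * eps) ^+ 2)); first by ring.
by rewrite x0 mul0r.
Qed.

Lemma sum_mul_motzkin_sqr_modp2 :
  \sum_(k < p) k%:R * (motzkin_nat k)%:R ^+ 2 = eps * (9 * p%:R - 1).
Proof.
apply: (mulrI four_unit); rewrite sum_mul_motzkin_sqr.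
rewrite sum_trinomial_mul_next trinomial_p1 trinomial_p.
have x0 := p_sqr0; apply: subr0_eq; set x := p%:R in x0 *.
transitivity (x * x * (- 5 * (1 + 3 * eps) ^+ 2 + 12 * (1 + 3 * eps)
   - 3 * x * (1 + 3 * eps) ^+ 2)); first by ring.
by rewrite x0 mul0r.
Qed.

Lemma sum_trinomial_motzkin_modp2 :
  6 * \sum_(k < p) (trinomial_nat k)%:R * (motzkin_nat k)%:R =
  8 * eps + p%:R * (1 - 9 * eps).
Proof.
rewrite sum_trinomial_motzkin.
rewrite sum_trinomial_mul_next trinomial_p1 trinomial_p.
have x0 := p_sqr0; apply: subr0_eq; set x := p%:R in x0 *.
transitivity (x * x * ((1 + 3 * eps) ^+ 2 - 4 * (1 + 3 * eps)
   + x * (1 + 3 * eps) ^+ 2)); first by ring.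
by rewrite x0 mul0r.
Qed.

End ModPSquare.

(** * From ['Z_(p ^ 2)] back to the rationals *)

Lemma legendre3_eps (R : comUnitRingType) p : prime p -> (3 < p)%N ->
  (legendre3 p%:Z)%:~R = eps R p.
Proof.
move=> pp p3; rewrite /legendre3 /eps; have := p_mod3 pp p3.
by case=> h; rewrite !modz_nat h.
Qed.

(** [denq x] is coprime to [numq x], hence divides [d]. *)
Lemma p_integral_frac p (d : nat) (c : int) (x : rat) :
  coprime p d -> d%:R * x = c%:~R -> p_integral p x.
Proof.
move=> pd dx; rewrite /p_integral coprime_sym; apply: coprime_dvdr pd.
have eq_int : d%:Z * numq x = c * denq x.
  apply: (@intr_inj rat); rewrite !rmorphM /= -dx -pmulrn -mulrA; congr (_ * _).
  by rewrite numqE.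
rewrite -(Gauss_dvdr (n := `|numq x|)) 1?coprime_sym ?coprime_num_den //.
by apply/dvdnP; exists `|c|%N; rewrite -abszM -eq_int abszM absz_nat mulnC.
Qed.

Lemma intr_Zp_eq0 q (z : int) : (1 < q)%N -> z%:~R = 0 :> 'Z_q -> (q %| `|z|)%N.
Proof.
move=> q1 z0; have : (`|z|%N)%:R = 0 :> 'Z_q.
  case: (intP z) z0 => [|n|n] //=; rewrite ?absz_nat ?abszN ?absz_nat //.
  by rewrite rmorphN => /eqP; rewrite oppr_eq0 => /eqP.
by move/(congr1 (@nat_of_ord _)); rewrite val_Zp_nat //= /dvdn => ->.
Qed.

Lemma eqmod_p2_intr p (d : nat) (z : int) (x y : rat) : prime p
  -> coprime p d ->
  z%:~R = 0 :> 'Z_(p ^ 2) -> d%:R * (x - y) = z%:~R -> eqmod_p2 p x y.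
Proof.
move=> pp pd z0 dxy.
have p2 : (1 < p ^ 2)%N by rewrite -(expn0 p) ltn_exp2l ?prime_gt1.
have /dvdnP[c ec] := intr_Zp_eq0 p2 z0.
apply: (@p_integral_frac p d (sgz z * c%:Z)) => //.
have p0 : p%:R != 0 :> rat by rewrite pnatr_eq0 -lt0n prime_gt0.
rewrite mulrA dxy; apply: (mulIf (expf_neq0 2 p0)); rewrite divfK ?expf_neq0 //.
rewrite {1}[z]intEsg ec PoszM mulrA [in LHS]rmorphM /=.
by rewrite -natrX pmulrn.
Qed.

Theorem theorem1p1 (p : nat) (hp : prime p) (hp5 : (5 <= p)%N) :
  [/\ eqmod_p2 p (\sum_(k < p) motzkin k ^+ 2)
        ((legendre3 p%:Z)%:Q * (2 - 6 * p%:R)),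
      eqmod_p2 p (\sum_(k < p) k%:R * motzkin k ^+ 2)
        ((legendre3 p%:Z)%:Q * (9 * p%:R - 1))
    & eqmod_p2 p (\sum_(k < p) central_trinomial k * motzkin k)
        (4 / 3 * (legendre3 p%:Z)%:Q
         + p%:R / 6 * (1 - 9 * (legendre3 p%:Z)%:Q))].
Proof.
have p3 : (3 < p)%N by lia.
have p2 : (1 < p ^ 2)%N by rewrite -(expn0 p) ltn_exp2l ?prime_gt1.
have sqr0 : p%:R * p%:R = 0 :> 'Z_(p ^ 2) by rewrite -natrM mulnn pchar_Zp.
have un n : ~~ (p %| n)%N -> (n%:R : 'Z_(p ^ 2)) \is a GRing.unit.
  by rewrite unitZpE // coprime_pexpl // prime_coprime.
have el := legendre3_eps 'Z_(p ^ 2) hp p3.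
set l := legendre3 p%:Z in el *.
under eq_bigr => k _ do rewrite motzkinE.
under [X in eqmod_p2 _ X (_ * (9 * _ - _))]eq_bigr => k _ do rewrite motzkinE.
under [X in eqmod_p2 _ X (_ + _)]eq_bigr => k _ do rewrite motzkinE
  central_trinomialE.
split.
- apply: (@eqmod_p2_intr p 1 (\sum_(k < p) (motzkin_nat k)%:Z ^+ 2 - l * (2 - 6
  * p%:Z))).
  + by [].
  + exact: coprimen1.
  + rewrite rmorphB rmorph_sum /= rmorphM rmorphB rmorphM /= el.
    under eq_bigr => k _ do rewrite rmorphXn /=.
    by rewrite sum_motzkin_sqr_modp2 // subrr.
  + rewrite mul1r rmorphB rmorph_sum /= rmorphM rmorphB rmorphM /=.
    by under [in RHS]eq_bigr => k _ do rewrite rmorphXn /=.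
- apply: (@eqmod_p2_intr p 1 (\sum_(k < p) k%:Z * (motzkin_nat k)%:Z ^+ 2 - l
  * (9 * p%:Z - 1))).
  + by [].
  + exact: coprimen1.
  + rewrite rmorphB rmorph_sum /= rmorphM rmorphB rmorphM /= el.
    under eq_bigr => k _ do rewrite rmorphM rmorphXn /=.
    by rewrite sum_mul_motzkin_sqr_modp2 // subrr.
  + rewrite mul1r rmorphB rmorph_sum /= rmorphM rmorphB rmorphM /=.
    by under [in RHS]eq_bigr => k _ do rewrite rmorphM rmorphXn /=.
(* The factor 6 clears the denominators 3 and 6, and is prime to [p] as [p > 3]. *)
apply: (@eqmod_p2_intr p 6 (6 * \sum_(k < p) (trinomial_nat k)%:Z
  * (motzkin_nat k)%:Z
   - (8 * l + p%:Z * (1 - 9 * l)))) => //.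
- by rewrite (coprimeMr p 2 3) !prime_coprime // !gtnNdvd //; lia.
- rewrite !(rmorphB, rmorphD, rmorphM, rmorph_sum) /= el.
  under eq_bigr => k _ do rewrite rmorphM /=.
  by rewrite sum_trinomial_motzkin_modp2 // subrr.
rewrite !(rmorphB, rmorphD, rmorphM, rmorph_sum) /=.
under [in RHS]eq_bigr => k _ do rewrite rmorphM /=.
by field.
Qed.
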